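(* Let $K$ be a field and let $E$ be a graph containing a cycle such that the Leavitt path algebra $\mathcal{L}=L_K(E)$ is a simple ring. Then $\mathbf{K}_{\mathcal{L}}\neq[\mathbf{K}_{\mathcal{L}},\mathbf{K}_{\mathcal{L}}]$.
   Context: A graph $E=(E^0,E^1,r,s)$ is a directed graph: a set $E^0$ of vertices, a set $E^1$ of edges (both arbitrary) and maps $r,s:E^1\to E^0$ (range and source). A vertex is regular if it emits at least one and only finitely many edges; ${\rm Reg}(E)$ is the set of regular vertices. A cycle based at $v$ is a sequence of edges $e_1\cdots e_n$ ($n\ge1$) with $r(e_i)=s(e_{i+1})$ for $1\le i<n$, $s(e_1)=r(e_n)=v$, and $s(e_i)\neq s(e_j)$ for all $i\neq j$. The Leavitt path algebra $L_K(E)$ is the free associative $K$-algebra generated by $E^0\cup E^1\cup (E^1)^*$ (where $(E^1)^*=\{e^*: e\in E^1\}$ is a set of formal symbols) subject to: (V) $vv'=\delta_{v,v'}v$ for $v,v'\in E^0$; (E1) $s(e)e=er(e)=e$ for $e\in E^1$; (E2) $r(e)e^*=e^*s(e)=e^*$ for $e\in E^1$; (CK1) $e^*f=\delta_{e,f}r(e)$ for $e,f\in E^1$; (CK2) $v=\sum_{e\in s^{-1}(v)}ee^*$ for every $v\in{\rm Reg}(E)$. It is not necessarily unital. The standard involution $^\star$ on $L_K(E)$ is the $K$-linear involution (anti-automorphism of order dividing 2) with $v\mapsto v$, $e\mapsto e^*$, $e^*\mapsto e$ for $v\in E^0$, $e\in E^1$. Put $\mathbf{K}_{\mathcal{L}}=\{x\in\mathcal{L}: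 x^\star=-x\}$. For a $K$-subspace $S$ of $\mathcal{L}$, $[S,S]$ denotes the $K$-span of $\{ab-ba: a,b\in S\}$. *)

(* Defs.v *)
From HB Require Import structures.
From mathcomp Require Import all_boot all_order all_algebra.
From mathcomp Require Import finmap boolp classical_sets functions cardinality.
From mathcomp Require Import fsbigop.

Set Implicit Arguments.
Unset Strict Implicit.
Unset Printing Implicit Defensive.

Import GRing.Theory.

Local Open Scope quotient_scope.
Local Open Scope classical_set_scope.
Local Open Scope ring_scope.

(* MathComp rings have a unit, but a Leavitt path algebra has one only when   *)
(* the graph has finitely many vertices; hence this structure of associative, *)
(* not necessarily unital, algebras.                                          *)
HB.mixin Record Lmodule_isNUAlgebra (K : pzRingType) A of GRing.Lmodule K A := {
  numul : A -> A -> A;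
  numulA : associative numul;
  numulDl : left_distributive numul +%R;
  numulDr : right_distributive numul +%R;
  nuscaleAl : forall (c : K) (x y : A), c *: numul x y = numul (c *: x) y;
  nuscaleAr : forall (c : K) (x y : A), c *: numul x y = numul x (c *: y)
}.

#[short(type="nuAlgType")]
HB.structure Definition NUAlgebra (K : pzRingType) :=
  {A of GRing.Lmodule K A & Lmodule_isNUAlgebra K A}.

Notation "x ** y" := (numul x y) (at level 40, left associativity) : ring_scope.

Section NonUnitalAlgebras.
Variables (K : pzRingType) (A : nuAlgType K).

(* A ring ideal: stability under the scalars of K is not required. *)
Definition two_sided_ideal (I : set A) : Prop :=
  [/\ I 0, (forall x y, I x -> I y -> I (x - y)) &
      forall a x, I x -> I (a ** x) /\ I (x ** a)].

(* Without a unit, the requirement that the ring be nonzero becomes the       *)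
(* requirement that its multiplication be nonzero.                            *)
Definition simple_ring : Prop :=
  (exists x y : A, x ** y <> 0) /\
  forall I : set A, two_sided_ideal I -> I = [set 0] \/ I = [set: A].

Definition linear_span (S : set A) : set A :=
  [set y | exists n (c : 'I_n -> K) (x : 'I_n -> A),
      (forall i, S (x i)) /\ y = \sum_(i < n) c i *: x i].

Definition commutator_span (S : set A) : set A :=
  linear_span [set z | exists a b, [/\ S a, S b & z = a ** b - b ** a]].

Definition skew_elements (star : A -> A) : set A := [set x | star x = - x].

End NonUnitalAlgebras.

Record graph := Graph {
  vertex : Type;
  edge : Type;
  esource : edge -> vertex;
  erange : edge -> vertex
}.

HB.instance Definition _ (E : graph) := gen_eqMixin (vertex E).
HB.instance Definition _ (E : graph) := gen_choiceMixin (vertex E).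
HB.instance Definition _ (E : graph) := gen_eqMixin (edge E).
HB.instance Definition _ (E : graph) := gen_choiceMixin (edge E).

Section Graphs.
Variable E : graph.

Definition emitted (v : vertex E) : set (edge E) := [set e | esource e = v].

Definition regular (v : vertex E) : Prop :=
  finite_set (emitted v) /\ emitted v !=set0.

Definition is_cycle_at (v : vertex E) (p : seq (edge E)) : bool :=
  if p is e :: q then
    [&& path (fun f g => erange f == esource g) e q,
        esource e == v, erange (last e q) == v
      & uniq [seq esource f | f <- p]]
  else false.

Definition has_cycle : Prop := exists v p, is_cycle_at v p.

End Graphs.

(* L_K(E) is the set of non-unital algebra expressions in the generators      *)
(* modulo the smallest congruence containing the axioms of associative        *)
(* K-algebras and the defining relations.                                     *)
Section LeavittPathAlgebra.
Variables (K : fieldType) (E : graph).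

Inductive lpa_term : Type :=
  | TVertex of vertex E
  | TEdge of edge E
  | TGhost of edge E
  | TZero
  | TAdd of lpa_term & lpa_term
  | TScale of K & lpa_term
  | TMul of lpa_term & lpa_term.

HB.instance Definition _ := gen_eqMixin lpa_term.
HB.instance Definition _ := gen_choiceMixin lpa_term.

(* The sum in CK2; fset_set enumerates a finite set without repetition. *)
Definition TCK2sum (v : vertex E) : lpa_term :=
  foldr TAdd TZero
    [seq TMul (TEdge e) (TGhost e) | e <- fset_set (emitted v)].

Inductive lpa_rel : lpa_term -> lpa_term -> Prop :=
  | rel_V v w :
      lpa_rel (TMul (TVertex v) (TVertex w))
              (if v == w then TVertex v else TZero)
  | rel_E1_source e : lpa_rel (TMul (TVertex (esource e)) (TEdge e)) (TEdge e)
  | rel_E1_range e : lpa_rel (TMul (TEdge e) (TVertex (erange e))) (TEdge e)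
  | rel_E2_range e : lpa_rel (TMul (TVertex (erange e)) (TGhost e)) (TGhost e)
  | rel_E2_source e : lpa_rel (TMul (TGhost e) (TVertex (esource e))) (TGhost e)
  | rel_CK1 e f :
      lpa_rel (TMul (TGhost e) (TEdge f))
              (if e == f then TVertex (erange e) else TZero)
  | rel_CK2 v : regular v -> lpa_rel (TVertex v) (TCK2sum v).

Inductive lpa_cong : lpa_term -> lpa_term -> Prop :=
  | cong_rel x y : lpa_rel x y -> lpa_cong x y
  | cong_refl x : lpa_cong x x
  | cong_sym x y : lpa_cong x y -> lpa_cong y x
  | cong_trans x y z : lpa_cong x y -> lpa_cong y z -> lpa_cong x z
  | cong_add x x' y y' :
      lpa_cong x x' -> lpa_cong y y' -> lpa_cong (TAdd x y) (TAdd x' y')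
  | cong_scale c x x' : lpa_cong x x' -> lpa_cong (TScale c x) (TScale c x')
  | cong_mul x x' y y' :
      lpa_cong x x' -> lpa_cong y y' -> lpa_cong (TMul x y) (TMul x' y')
  | cong_addA x y z : lpa_cong (TAdd x (TAdd y z)) (TAdd (TAdd x y) z)
  | cong_addC x y : lpa_cong (TAdd x y) (TAdd y x)
  | cong_add0 x : lpa_cong (TAdd TZero x) x
  | cong_addN x : lpa_cong (TAdd (TScale (-1) x) x) TZero
  | cong_scaleA c d x : lpa_cong (TScale c (TScale d x)) (TScale (c * d) x)
  | cong_scale1 x : lpa_cong (TScale 1 x) x
  | cong_scaleDr c x y :
      lpa_cong (TScale c (TAdd x y)) (TAdd (TScale c x) (TScale c y))
  | cong_scaleDl c d x :
      lpa_cong (TScale (c + d) x) (TAdd (TScale c x) (TScale d x))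
  | cong_mulA x y z : lpa_cong (TMul x (TMul y z)) (TMul (TMul x y) z)
  | cong_mulDl x y z :
      lpa_cong (TMul (TAdd x y) z) (TAdd (TMul x z) (TMul y z))
  | cong_mulDr x y z :
      lpa_cong (TMul x (TAdd y z)) (TAdd (TMul x y) (TMul x z))
  | cong_scaleAl c x y : lpa_cong (TScale c (TMul x y)) (TMul (TScale c x) y)
  | cong_scaleAr c x y : lpa_cong (TScale c (TMul x y)) (TMul x (TScale c y)).

Definition lpa_eqv (x y : lpa_term) : bool := `[< lpa_cong x y >].

Lemma lpa_eqv_refl : reflexive lpa_eqv.
Proof. by move=> x; apply/asboolP; exact: cong_refl. Qed.

Lemma lpa_eqv_sym : symmetric lpa_eqv.
Proof. by move=> x y; apply/asboolP/asboolP => /cong_sym. Qed.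

Lemma lpa_eqv_trans : transitive lpa_eqv.
Proof.
by move=> y x z /asboolP xy /asboolP yz; apply/asboolP; exact: cong_trans yz.
Qed.

Canonical lpa_equiv := EquivRel lpa_eqv lpa_eqv_refl lpa_eqv_sym lpa_eqv_trans.

Definition lpa : Type := {eq_quot lpa_equiv}.

HB.instance Definition _ := Choice.on lpa.
HB.instance Definition _ := EqQuotient.on lpa.

Lemma lpa_piP (x y : lpa_term) : \pi_lpa x = \pi_lpa y <-> lpa_cong x y.
Proof. by split => [/eqmodP/asboolP//|xy]; apply/eqmodP/asboolP. Qed.

Definition lpa_zero : lpa := \pi_lpa TZero.
Definition lpa_add : lpa -> lpa -> lpa := lift_op2 lpa TAdd.
Definition lpa_scale (c : K) : lpa -> lpa := lift_op1 lpa (TScale c).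
Definition lpa_mul : lpa -> lpa -> lpa := lift_op2 lpa TMul.

Lemma lpa_reprP (x : lpa_term) : lpa_cong (repr (\pi_lpa x)) x.
Proof. by apply/lpa_piP; rewrite reprK. Qed.

Lemma pi_lpa_add x y : lpa_add (\pi_lpa x) (\pi_lpa y) = \pi_lpa (TAdd x y).
Proof. by unlock lpa_add; apply/lpa_piP/cong_add; exact: lpa_reprP. Qed.

Lemma pi_lpa_scale c x : lpa_scale c (\pi_lpa x) = \pi_lpa (TScale c x).
Proof. by unlock lpa_scale; apply/lpa_piP/cong_scale; exact: lpa_reprP. Qed.

Lemma pi_lpa_mul x y : lpa_mul (\pi_lpa x) (\pi_lpa y) = \pi_lpa (TMul x y).
Proof. by unlock lpa_mul; apply/lpa_piP/cong_mul; exact: lpa_reprP. Qed.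

Let lpaE := (pi_lpa_add, pi_lpa_scale, pi_lpa_mul).

Lemma lpa_addA : associative lpa_add.
Proof.
elim/quotW=> x; elim/quotW=> y; elim/quotW=> z; rewrite !lpaE.
by apply/lpa_piP; exact: cong_addA.
Qed.

Lemma lpa_addC : commutative lpa_add.
Proof.
by elim/quotW=> x; elim/quotW=> y; rewrite !lpaE; apply/lpa_piP; exact: cong_addC.
Qed.

Lemma lpa_add0 : left_id lpa_zero lpa_add.
Proof. by elim/quotW=> x; rewrite !lpaE; apply/lpa_piP; exact: cong_add0. Qed.

Lemma lpa_addN : left_inverse lpa_zero (lpa_scale (-1)) lpa_add.
Proof. by elim/quotW=> x; rewrite !lpaE; apply/lpa_piP; exact: cong_addN. Qed.

HB.instance Definition _ :=
  GRing.isZmodule.Build lpa lpa_addA lpa_addC lpa_add0 lpa_addN.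

Lemma lpa_scaleA c d x : lpa_scale c (lpa_scale d x) = lpa_scale (c * d) x.
Proof. by elim/quotW: x => x; rewrite !lpaE; apply/lpa_piP; exact: cong_scaleA. Qed.

Lemma lpa_scale1 : left_id 1 lpa_scale.
Proof. by elim/quotW=> x; rewrite !lpaE; apply/lpa_piP; exact: cong_scale1. Qed.

Lemma lpa_scaleDr : right_distributive lpa_scale lpa_add.
Proof.
move=> c; elim/quotW=> x; elim/quotW=> y; rewrite !lpaE.
by apply/lpa_piP; exact: cong_scaleDr.
Qed.

Lemma lpa_scaleDl x : {morph lpa_scale^~ x : c d / c + d >-> lpa_add c d}.
Proof.
by elim/quotW: x => x c d; rewrite /= !lpaE; apply/lpa_piP; exact: cong_scaleDl.
Qed.

HB.instance Definition _ := GRing.Zmodule_isLmodule.Build K lpa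
  lpa_scaleA lpa_scale1 lpa_scaleDr lpa_scaleDl.

Lemma lpa_mulA : associative lpa_mul.
Proof.
elim/quotW=> x; elim/quotW=> y; elim/quotW=> z; rewrite !lpaE.
by apply/lpa_piP; exact: cong_mulA.
Qed.

Lemma lpa_mulDl : left_distributive lpa_mul lpa_add.
Proof.
elim/quotW=> x; elim/quotW=> y; elim/quotW=> z; rewrite !lpaE.
by apply/lpa_piP; exact: cong_mulDl.
Qed.

Lemma lpa_mulDr : right_distributive lpa_mul lpa_add.
Proof.
elim/quotW=> x; elim/quotW=> y; elim/quotW=> z; rewrite !lpaE.
by apply/lpa_piP; exact: cong_mulDr.
Qed.

Lemma lpa_scaleAl c x y : lpa_scale c (lpa_mul x y) = lpa_mul (lpa_scale c x) y.
Proof.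
elim/quotW: x => x; elim/quotW: y => y; rewrite !lpaE.
by apply/lpa_piP; exact: cong_scaleAl.
Qed.

Lemma lpa_scaleAr c x y : lpa_scale c (lpa_mul x y) = lpa_mul x (lpa_scale c y).
Proof.
elim/quotW: x => x; elim/quotW: y => y; rewrite !lpaE.
by apply/lpa_piP; exact: cong_scaleAr.
Qed.

HB.instance Definition _ := Lmodule_isNUAlgebra.Build K lpa
  lpa_mulA lpa_mulDl lpa_mulDr lpa_scaleAl lpa_scaleAr.

Definition lpa_vertex (v : vertex E) : lpa := \pi_lpa (TVertex v).
Definition lpa_edge (e : edge E) : lpa := \pi_lpa (TEdge e).
Definition lpa_ghost (e : edge E) : lpa := \pi_lpa (TGhost e).

Lemma pi_lpaD x y : \pi_lpa (TAdd x y) = \pi_lpa x + \pi_lpa y.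
Proof. by rewrite -pi_lpa_add. Qed.

Lemma pi_lpaZ c x : \pi_lpa (TScale c x) = c *: \pi_lpa x.
Proof. by rewrite -pi_lpa_scale. Qed.

Lemma pi_lpaM x y : \pi_lpa (TMul x y) = \pi_lpa x ** \pi_lpa y.
Proof. by rewrite -pi_lpa_mul. Qed.

Lemma lpa_V v w :
  lpa_vertex v ** lpa_vertex w = if v == w then lpa_vertex v else 0.
Proof.
rewrite -pi_lpaM (_ : (if _ then _ else _) =
  \pi_lpa (if v == w then TVertex v else TZero)); last by case: ifP.
exact/lpa_piP/cong_rel/rel_V.
Qed.

Lemma lpa_E1 e :
  lpa_vertex (esource e) ** lpa_edge e = lpa_edge e /\
  lpa_edge e ** lpa_vertex (erange e) = lpa_edge e.
Proof.
by rewrite -!pi_lpaM; split; apply/lpa_piP/cong_rel;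
  [exact: rel_E1_source|exact: rel_E1_range].
Qed.

Lemma lpa_E2 e :
  lpa_vertex (erange e) ** lpa_ghost e = lpa_ghost e /\
  lpa_ghost e ** lpa_vertex (esource e) = lpa_ghost e.
Proof.
by rewrite -!pi_lpaM; split; apply/lpa_piP/cong_rel;
  [exact: rel_E2_range|exact: rel_E2_source].
Qed.

Lemma lpa_CK1 e f :
  lpa_ghost e ** lpa_edge f = if e == f then lpa_vertex (erange e) else 0.
Proof.
rewrite -pi_lpaM (_ : (if _ then _ else _) =
  \pi_lpa (if e == f then TVertex (erange e) else TZero)); last by case: ifP.
exact/lpa_piP/cong_rel/rel_CK1.
Qed.

Lemma lpa_CK2 v : regular v ->
  lpa_vertex v = \sum_(e \in emitted v) lpa_edge e ** lpa_ghost e.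
Proof.
move=> vreg; rewrite fsbig_finite; last by case: vreg.
transitivity (\pi_lpa (TCK2sum v)); first exact/lpa_piP/cong_rel/rel_CK2.
rewrite /TCK2sum; elim: (enum_fset _) => [|e s IHs] /=; first by rewrite big_nil.
by rewrite big_cons pi_lpaD pi_lpaM IHs.
Qed.

Fixpoint term_star (x : lpa_term) : lpa_term :=
  match x with
  | TVertex v => TVertex v
  | TEdge e => TGhost e
  | TGhost e => TEdge e
  | TZero => TZero
  | TAdd y z => TAdd (term_star y) (term_star z)
  | TScale c y => TScale c (term_star y)
  | TMul y z => TMul (term_star z) (term_star y)
  end.

Lemma term_star_sum v : term_star (TCK2sum v) = TCK2sum v.
Proof. by rewrite /TCK2sum; elim: (enum_fset _) => //= e s ->. Qed.

Lemma term_star_rel x y :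
  lpa_rel x y -> lpa_cong (term_star x) (term_star y).
Proof.
case=> [v w|e|e|e|e|e f|v vreg] /=; try by apply: cong_rel; constructor.
- apply: cong_rel; have := rel_V w v; rewrite (eq_sym w v).
  by case: (eqVneq v w) => [->|].
- apply: cong_rel; have := rel_CK1 f e; rewrite (eq_sym f e).
  by case: (eqVneq e f) => [->|].
- by rewrite term_star_sum; apply: cong_rel; constructor.
Qed.

Lemma term_star_cong x y :
  lpa_cong x y -> lpa_cong (term_star x) (term_star y).
Proof.
elim=> {x y} /=; try by constructor.
- exact: term_star_rel.
- by move=> x y z _ xy _ yz; exact: cong_trans yz.
- by move=> x y z; apply/cong_sym/cong_mulA.
Qed.

Definition lpa_star : lpa -> lpa := lift_op1 lpa term_star.

Lemma pi_lpa_star x : lpa_star (\pi_lpa x) = \pi_lpa (term_star x).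
Proof. by unlock lpa_star; apply/lpa_piP/term_star_cong/lpa_reprP. Qed.

Lemma lpa_starD x y : lpa_star (x + y) = lpa_star x + lpa_star y.
Proof.
elim/quotW: x => x; elim/quotW: y => y.
by rewrite -pi_lpaD !pi_lpa_star -pi_lpaD.
Qed.

Lemma lpa_starZ c x : lpa_star (c *: x) = c *: lpa_star x.
Proof. by elim/quotW: x => x; rewrite -pi_lpaZ !pi_lpa_star -pi_lpaZ. Qed.

Lemma lpa_starM x y : lpa_star (x ** y) = lpa_star y ** lpa_star x.
Proof.
elim/quotW: x => x; elim/quotW: y => y.
by rewrite -pi_lpaM !pi_lpa_star -pi_lpaM.
Qed.

Lemma lpa_starK : involutive lpa_star.
Proof.
elim/quotW=> x; rewrite !pi_lpa_star; congr \pi_lpa.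
by elim: x => //= [x -> y ->|c x ->|x -> y ->].
Qed.

Lemma lpa_star_vertex v : lpa_star (lpa_vertex v) = lpa_vertex v.
Proof. exact: pi_lpa_star. Qed.

Lemma lpa_star_edge e : lpa_star (lpa_edge e) = lpa_ghost e.
Proof. exact: pi_lpa_star. Qed.

Lemma lpa_star_ghost e : lpa_star (lpa_ghost e) = lpa_edge e.
Proof. exact: pi_lpa_star. Qed.

End LeavittPathAlgebra.

(* Main.v *)
Require Import Defs.
From HB Require Import structures.
From mathcomp Require Import all_boot all_order all_algebra.
From mathcomp Require Import boolp classical_sets.
From mathcomp Require Import finmap cardinality zify.

(** The skew element [c - c^*], for a cycle [c], is not even a linear
    combination of commutators of the whole algebra: some linear form on the
    algebra is a trace, that is, vanishes on every [xy - yx], and takes the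
    value 1 at [c - c^*].

    The algebra acts on the infinite paths of the graph: a vertex is the
    idempotent selecting the paths which start there, an edge [e] prepends
    itself, and [e^*] removes a leading [e].  Each word in the generators
    thereby becomes a partial injection, and it has a degree, its number of
    edges minus its number of ghost edges.  Let [d] be the length of [c].  The
    trace sends a word of degree [d] to its number of fixed infinite paths and
    every other word to 0.  A word of positive degree is a contraction for the
    prefix metric, so that this number is 0 or 1 ([fixed_path_unique]); hence
    the trace of a word just tests whether a fixed path exists
    ([word_trace]).

    - [uv] and [vu] have the same degree, and [v] carries a fixed path of [uv]
      to one of [vu]; this is the trace property ([word_trace_catC]).
    - All defining relations but CK2 are equalities of partial injections.  For
      CK2, a fixed path at [v] is counted once in the sum over the edges [e]
      leaving [v], namely at its first edge; here the uniqueness of the fixed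
      path shows that it is not counted at other edges ([word_trace_CK2]).
    - The word [c] has degree [d] and fixes the periodic path [ccc...], whereas
      [c^*] has degree [-d], which differs from [d]. *)

Set Implicit Arguments.
Unset Strict Implicit.
Unset Printing Implicit Defensive.

Import GRing.Theory.
Local Open Scope ring_scope.

(** * Words acting on infinite paths *)

Section Words.
Variable E : graph.

Inductive letter := LVertex of vertex E | LEdge of edge E | LGhost of edge E.

Definition is_edge (a : letter) := if a is LEdge _ then true else false.
Definition is_ghost (a : letter) := if a is LGhost _ then true else false.

Definition infinite_path (z : nat -> edge E) : Prop :=
  forall i, erange (z i) = esource (z i.+1).

Definition stail (z : nat -> edge E) : nat -> edge E := fun i => z i.+1.

Definition scons (e : edge E) (z : nat -> edge E) : nat -> edge E :=
  fun i => if i is j.+1 then z j else e.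

(** The graph of the partial injection [z |-> y] given by a letter; both [z]
    and [y] are forced to be infinite paths. *)
Definition step (a : letter) (z y : nat -> edge E) : Prop :=
  match a with
  | LVertex v => [/\ infinite_path z, esource (z 0) = v & y = z]
  | LEdge e => [/\ infinite_path y, y 0 = e & z = stail y]
  | LGhost e => [/\ infinite_path z, z 0 = e & y = stail z]
  end.

Fixpoint act (w : seq letter) (z y : nat -> edge E) : Prop :=
  if w is a :: u then exists x, act u z x /\ step a x y else y = z.

Lemma act_cat u w z y :
  act (u ++ w) z y <-> exists x, act w z x /\ act u x y.
Proof.
elim: u y => [|a u IH] y /=.
  by split=> [zy|[x [zx ->]]] //; exists y.
split=> [[x [/IH[t [zt tx]] xy]]|[t [zt [x [tx xy]]]]].
  by exists t; split=> //; exists x.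
by exists x; split=> //; apply/IH; exists t.
Qed.

(** A word of degree [d] lengthens common prefixes by [d]. *)
Lemma act_prefix w z z' y y' N M :
    act w z y -> act w z' y' -> (forall i, i < N -> z i = z' i)%N ->
    (M + count is_ghost w <= N + count is_edge w)%N ->
  (forall i, i < M -> y i = y' i)%N.
Proof.
elim: w y y' M => [|a w IH] y y' M /=.
  by move=> -> -> zz' MN i iM; apply: zz'; lia.
move=> [x [zx xy]] [x' [zx' xy']] zz'.
case: a xy xy' => [v|e|e] /= [_ h1 h2] [_ h1' h2'] MN i iM.
- by rewrite h2 h2'; apply: (IH _ _ M) => //; lia.
- case: i iM => [_|i iM]; first by rewrite h1 h1'.
  have := IH x x' M.-1 zx zx' zz' _ i; rewrite h2 h2' /stail.
  by apply; lia.
- by rewrite h2 h2'; apply: (IH _ _ M.+1 zx zx' zz') => //; lia.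
Qed.

Lemma fixed_path_unique w z z' :
  (count is_ghost w < count is_edge w)%N -> act w z z -> act w z' z' -> z = z'.
Proof.
move=> deg wz wz'.
have agree N : (forall i, i < N -> z i = z' i)%N.
  elim: N => [//|N IH]; apply: (act_prefix wz wz' IH).
  by lia.
by apply/funext => i; exact: (agree i.+1).
Qed.

Lemma scons_path e z :
  infinite_path z -> erange e = esource (z 0) -> infinite_path (scons e z).
Proof. by move=> pz ez [|i] /=. Qed.

(** * The trace of a word *)

Section WordTrace.
Variables (K : pzRingType) (d : nat).

(** By [fixed_path_unique] the number of fixed paths is 0 or 1 when [0 < d], so
    that their existence gives their number. *)
Definition word_trace (w : seq letter) : K :=
  `[< (count is_ghost w + d = count is_edge w)%N /\ exists z, act w z z >]%:R.

Lemma word_trace_catC u w : word_trace (u ++ w) = word_trace (w ++ u).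
Proof.
rewrite /word_trace !count_cat; congr (nat_of_bool _)%:R.
have rot (a b : seq letter) : (exists z, act (a ++ b) z z) ->
    exists z, act (b ++ a) z z.
  move=> [z /act_cat[x [bzx axz]]].
  by exists x; apply/act_cat; exists z.
by apply/asbool_equiv_eq; split=> -[deg /rot]; split=> //; lia.
Qed.

Lemma word_trace_ext u u' w :
    (forall z y, act u z y <-> act u' z y) ->
    (count is_ghost u + count is_edge u' =
     count is_ghost u' + count is_edge u)%N ->
  word_trace (u ++ w) = word_trace (u' ++ w).
Proof.
move=> uu' deg; rewrite /word_trace !count_cat; congr (nat_of_bool _)%:R.
apply/asbool_equiv_eq; split=> -[deg' [z /act_cat[x [wzx uxz]]]].
  by split; [lia | exists z; apply/act_cat; exists x; split=> //; apply/uu'].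
by split; [lia | exists z; apply/act_cat; exists x; split=> //; apply/uu'].
Qed.

Lemma word_trace_empty u w :
  (forall z y, ~ act u z y) -> word_trace (u ++ w) = 0.
Proof.
move=> u0; rewrite /word_trace asboolF // => -[_ [z /act_cat[x [_]]]].
exact: u0.
Qed.

Lemma word_trace_V v v' w :
  word_trace ([:: LVertex v; LVertex v'] ++ w) =
  if v == v' then word_trace ([:: LVertex v] ++ w) else 0.
Proof.
case: eqVneq => [<-|vv'].
  apply: word_trace_ext => // z y /=; split.
    by move=> [x [[_ [-> [p sz ->]]] [_ _ ->]]]; exists z.
  by move=> [_ [-> [p sz ->]]]; exists z; split=> //; exists z.
apply: word_trace_empty => z y /= [x [[_ [-> [p sz ->]]] [_ sz' _]]].
by case/eqP: vv'; rewrite -sz -sz'.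
Qed.

Lemma word_trace_E1_source e w :
  word_trace ([:: LVertex (esource e); LEdge e] ++ w) =
  word_trace ([:: LEdge e] ++ w).
Proof.
apply: word_trace_ext => // z y /=; split.
  by move=> [x [[_ [-> ex]] [_ _ ->]]]; exists z.
move=> [_ [-> [p ye ->]]]; exists y; split; last by split=> //; rewrite ye.
by exists (stail y).
Qed.

Lemma word_trace_E1_range e w :
  word_trace ([:: LEdge e; LVertex (erange e)] ++ w) =
  word_trace ([:: LEdge e] ++ w).
Proof.
apply: word_trace_ext => // z y /=; split.
  by move=> [x [[_ [-> [_ _ ->]]] ex]]; exists z.
move=> [_ [-> [p ye ->]]]; exists (stail y); split=> //.
exists (stail y); split=> //; split=> //; first by move=> i; exact: p.
by rewrite -ye p.
Qed.

Lemma word_trace_E2_range e w :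
  word_trace ([:: LVertex (erange e); LGhost e] ++ w) =
  word_trace ([:: LGhost e] ++ w).
Proof.
apply: word_trace_ext => // z y /=; split.
  by move=> [x [[_ [-> ex]] [_ _ ->]]]; exists z.
move=> [_ [-> [p ze ->]]]; exists (stail z); split; first by exists z.
by split=> //; [move=> i; exact: p | rewrite -ze p].
Qed.

Lemma word_trace_E2_source e w :
  word_trace ([:: LGhost e; LVertex (esource e)] ++ w) =
  word_trace ([:: LGhost e] ++ w).
Proof.
apply: word_trace_ext => // z y /=; split.
  by move=> [x [[_ [-> [_ _ ->]]] ex]]; exists z.
move=> [_ [-> [p ze ->]]]; exists z; split=> //.
by exists z; split=> //; split=> //; rewrite ze.
Qed.

Lemma word_trace_CK1 e f w :
  word_trace ([:: LGhost e; LEdge f] ++ w) =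
  if e == f then word_trace ([:: LVertex (erange e)] ++ w) else 0.
Proof.
case: eqVneq => [<-|ef].
  apply: word_trace_ext => // z y /=; split.
    move=> [x [[_ [-> [p xe ->]]] [_ _ ->]]].
    exists (stail x); split=> //; split=> //; first by move=> i; exact: p.
    by rewrite -xe p.
  move=> [_ [-> [p se ->]]]; have pez := scons_path p (esym se).
  exists (scons e z); split; last by split.
  by exists z; split=> //; split.
apply: word_trace_empty => z y /= [x [[_ [_ [_ xf _]]] [_ xe _]]].
by case/eqP: ef; rewrite -xf -xe.
Qed.

Hypothesis d_gt0 : (0 < d)%N.

Lemma word_trace_CK2 v w : regular v ->
  word_trace ([:: LVertex v] ++ w) =
  \sum_(e <- fset_set (emitted v)) word_trace ([:: LEdge e; LGhost e] ++ w).
Proof.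
move=> [vfin _].
(* A path fixed by [e e^* w], or by [v w], starts by [e], or at [v]; hence the
   other factor [w] fixes it too, and uniqueness applies to [w]. *)
have fixE e : (exists z, act ([:: LEdge e; LGhost e] ++ w) z z) <->
    exists z, [/\ act w z z, infinite_path z & z 0 = e].
  split=> [[z /= [t [[x [wzx [px xe tx]]] [pz ze tz]]]]|[z [wz pz ze]]].
    have xz : x = z.
      apply/funext => -[|i]; first by rewrite xe ze.
      by move: tz; rewrite tx => /(congr1 (@^~ i)).
    by exists z; rewrite xz in wzx.
  by exists z; exists (stail z); split=> //; exists z.
have fixV : (exists z, act ([:: LVertex v] ++ w) z z) <->
    exists z, [/\ act w z z, infinite_path z & esource (z 0) = v].
  split=> [[z /= [x [wzx [px xv zx]]]]|[z [wz pz zv]]].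
    by exists z; rewrite -zx in wzx px xv.
  by exists z; exists z.
have [deg|deg] :=
    pselect (count is_ghost w + d = count is_edge w)%N; last first.
  rewrite big1_seq => [|e _]; rewrite /word_trace asboolF //= !add0n.
    by move=> -[].
  by move=> -[]; lia.
have [[z [wz pz zv]]|nofix] := pselect
    (exists z, [/\ act w z z, infinite_path z & esource (z 0) = v]).
  have z0v : z 0 \in fset_set (emitted v) by rewrite in_fset_set // in_setE.
  rewrite (big_rem (z 0)) //= big1_seq ?addr0 => [|e /=].
    rewrite /word_trace !asboolT //=; split=> //; try lia.
      by apply/fixE; exists z.
    by apply/fixV; exists z.
  rewrite rem_filter ?fset_uniq // mem_filter => /andP[/= ez _].
  rewrite /word_trace asboolF // => -[_ /fixE[z' [wz' _ z'e]]].
  have zz' : z = z' by apply: (fixed_path_unique _ wz wz'); lia.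
  by case/eqP: ez; rewrite zz'.
rewrite big1_seq => [|e /= ev]; rewrite /word_trace asboolF //.
  by move=> -[_ /fixV].
move=> -[_ /fixE[z [wz pz ze]]]; apply: nofix; exists z; split=> //.
by move: ev; rewrite in_fset_set // in_setE ze.
Qed.

End WordTrace.

(** * The trace of an element of the algebra *)

Section Pairing.
Variable K : fieldType.

(** The value at the word combination denoted by [x] of the linear extension
    of [f] to the free algebra.  Evaluating in this continuation-passing form
    avoids a construction of the free algebra. *)
Fixpoint pairing (x : lpa_term K E) (f : seq letter -> K) : K :=
  match x with
  | TVertex v => f [:: LVertex v]
  | TEdge e => f [:: LEdge e]
  | TGhost e => f [:: LGhost e]
  | TZero => 0
  | TAdd y z => pairing y f + pairing z f
  | TScale c y => c * pairing y f
  | TMul y z => pairing y (fun s => pairing z (fun t => f (s ++ t)))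
  end.

Lemma eq_pairing x f g : f =1 g -> pairing x f = pairing x g.
Proof. by move=> /funext ->. Qed.

Lemma pairing0 x : pairing x (fun=> 0) = 0.
Proof.
by elim: x => //= [x -> y ->|c x ->|x IHx y ->]; rewrite ?addr0 ?mulr0.
Qed.

Lemma pairingD x f g :
  pairing x (fun s => f s + g s) = pairing x f + pairing x g.
Proof.
elim: x f g => //= [|x IHx y IHy|c x IHx|x IHx y IHy] f g.
- by rewrite addr0.
- by rewrite IHx IHy addrACA.
- by rewrite IHx mulrDr.
- by rewrite -IHx; apply: eq_pairing => s; exact: IHy.
Qed.

Lemma pairingZ x c f : pairing x (fun s => c * f s) = c * pairing x f.
Proof.
elim: x f => //= [|x IHx y IHy|b x IHx|x IHx y IHy] f.
- by rewrite mulr0.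
- by rewrite IHx IHy mulrDr.
- by rewrite IHx mulrCA.
- by rewrite -IHx; apply: eq_pairing => s; exact: IHy.
Qed.

Lemma pairing_exchange x y (g : seq letter -> seq letter -> K) :
  pairing x (fun s => pairing y (g s)) =
  pairing y (fun t => pairing x (fun s => g s t)).
Proof.
elim: x g => //= [|x IHx x' IHx'|c x IHx|x IHx x' IHx'] g.
- by rewrite pairing0.
- by rewrite IHx IHx' pairingD.
- by rewrite IHx pairingZ.
- rewrite -IHx; apply: eq_pairing => s; exact: IHx'.
Qed.

Lemma pairing_CK2 v f :
  pairing (TCK2sum K v) f =
  \sum_(e <- fset_set (emitted v)) f [:: LEdge e; LGhost e].
Proof.
rewrite /TCK2sum; elim: (enum_fset _) => [|e s IHs] /=.
  by rewrite big_nil.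
by rewrite big_cons IHs.
Qed.

Variable d : nat.
Hypothesis d_gt0 : (0 < d)%N.

(** Congruence is generated from the defining relations by products on both
    sides; by the trace property a product on one side is all that has to be
    allowed for, and this is the word [w]. *)
Lemma pairing_cong x y : lpa_cong x y -> forall w,
  pairing x (fun s => word_trace K d (s ++ w)) =
  pairing y (fun s => word_trace K d (s ++ w)).
Proof.
elim=> {x y} //=.
- move=> x y [v v'|e|e|e|e|e f|v vreg] w /=.
  + by have := word_trace_V K d v v' w; case: ifP.
  + exact: word_trace_E1_source.
  + exact: word_trace_E1_range.
  + exact: word_trace_E2_range.
  + exact: word_trace_E2_source.
  + by have := word_trace_CK1 K d e f w; case: ifP.
  + by rewrite pairing_CK2; exact: word_trace_CK2.
- by move=> x y z _ xy _ yz w; rewrite xy.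
- by move=> x x' y y' _ IHx _ IHy w; rewrite IHx IHy.
- by move=> c x x' _ IHx w; rewrite IHx.
- move=> x x' y y' _ IHx _ IHy w.
  (* Replace [x] in front of the word [t w], then rotate the trace to bring
     [y] to the front, with the word [w s] behind it. *)
  transitivity (pairing y (fun t =>
      pairing x (fun s => word_trace K d (s ++ (t ++ w))))).
    rewrite pairing_exchange; apply: eq_pairing => t.
    by apply: eq_pairing => s; rewrite catA.
  under eq_pairing => t do rewrite IHx.
  rewrite -pairing_exchange; apply: eq_pairing => s.
  transitivity (pairing y (fun t => word_trace K d (t ++ (w ++ s)))).
    by apply: eq_pairing => t; rewrite word_trace_catC -catA.
  rewrite IHy; apply: eq_pairing => t.
  by rewrite catA word_trace_catC catA.
- by move=> *; rewrite addrA.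
- by move=> *; rewrite addrC.
- by move=> *; rewrite add0r.
- by move=> *; rewrite mulN1r addNr.
- by move=> *; rewrite mulrA.
- by move=> *; rewrite mul1r.
- by move=> *; rewrite mulrDr.
- by move=> *; rewrite mulrDl.
- move=> x y z w; do 3![apply: eq_pairing => ?]; by rewrite !catA.
- by move=> x y z w; rewrite -pairingD.
- by move=> c x y w; rewrite pairingZ.
Qed.

Definition lpa_trace (x : lpa K E) : K := pairing (repr x) (word_trace K d).

Lemma pi_lpa_trace x :
  lpa_trace (\pi_(lpa K E) x)%qT = pairing x (word_trace K d).
Proof.
have := pairing_cong (lpa_reprP x) [::]; rewrite /lpa_trace.
by under eq_pairing => s do rewrite cats0; move=> ->;
  apply: eq_pairing => s; rewrite cats0.
Qed.

Lemma lpa_traceD x y : lpa_trace (x + y) = lpa_trace x + lpa_trace y.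
Proof.
elim/quotW: x => x; elim/quotW: y => y.
by rewrite -pi_lpaD !pi_lpa_trace.
Qed.

Lemma lpa_traceZ c x : lpa_trace (c *: x) = c * lpa_trace x.
Proof. by elim/quotW: x => x; rewrite -pi_lpaZ !pi_lpa_trace. Qed.

Lemma lpa_traceB x y : lpa_trace (x - y) = lpa_trace x - lpa_trace y.
Proof. by rewrite -[- y]scaleN1r lpa_traceD lpa_traceZ mulN1r. Qed.

Lemma lpa_traceC x y : lpa_trace (x ** y) = lpa_trace (y ** x).
Proof.
elim/quotW: x => x; elim/quotW: y => y.
rewrite -!pi_lpaM !pi_lpa_trace /= pairing_exchange; apply: eq_pairing => t.
by apply: eq_pairing => s; exact: word_trace_catC.
Qed.

Lemma lpa_trace_commutator_span (S : set (lpa K E)) x :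
  commutator_span S x -> lpa_trace x = 0.
Proof.
move=> [n [c [u [uS ->]]]].
elim: n c u uS => [|n IH] c u uS.
  by rewrite big_ord0 -(scale0r 0) lpa_traceZ mul0r.
rewrite big_ord_recl lpa_traceD IH => [|i]; last exact: uS.
have [a [b [_ _ ->]]] := uS ord0.
by rewrite lpa_traceZ lpa_traceB lpa_traceC subrr mulr0 addr0.
Qed.

End Pairing.

(** * The trace of a cycle *)

Section Cycle.
Variable K : fieldType.

(** A cycle has at least one edge [e]; this form avoids an empty product,
    which would have no value without a unit. *)
Fixpoint path_term (e : edge E) (q : seq (edge E)) : lpa_term K E :=
  if q is f :: q' then TMul (TEdge K e) (path_term f q') else TEdge K e.

Lemma pairing_path_term e q f :
  pairing (path_term e q) f = f [seq LEdge a | a <- e :: q].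
Proof. by elim: q e f => //= a q IH e f; rewrite IH. Qed.

Lemma pairing_star_path_term e q f :
  pairing (term_star (path_term e q)) f = f [seq LGhost a | a <- rev (e :: q)].
Proof.
elim: q e f => [//|a q IH] e f.
by rewrite [LHS]IH [in RHS]rev_cons map_rcons cats1.
Qed.

Lemma act_edges n y : infinite_path y ->
  act [seq LEdge a | a <- mkseq y n] (fun i => y (n + i)%N) y.
Proof.
elim: n y => [//|n IH] y py.
have -> : mkseq y n.+1 = y 0 :: mkseq (stail y) n.
  by rewrite /mkseq /= -[1%N]addn0 iotaDl -map_comp.
exists (stail y); split; last by split.
by apply: (IH (stail y)) => i; exact: py.
Qed.

(** The path fixed by the cycle is the cycle repeated forever. *)
Lemma word_trace_cycle v e q : is_cycle_at v (e :: q) ->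
  word_trace K (size q).+1 [seq LEdge a | a <- e :: q] = 1.
Proof.
set p := e :: q => /and4P[eq_path /eqP es /eqP qr _].
pose z i := nth e p (i %% size p).
have pz : infinite_path z.
  move=> i; rewrite /z -(addn1 i) -modnDml addn1.
  have : (i %% size p < size p)%N by rewrite ltn_mod.
  move: (i %% size p)%N => j; rewrite leq_eqVlt => /orP[/eqP jp|jp].
    have -> : j = size q by case: jp.
    by rewrite modnn -[size q]/(size p).-1 nth_last /= qr es.
  rewrite modn_small //.
  by have /(pathP e)/(_ j) := eq_path; rewrite -ltnS => /(_ jp)/eqP.
have pE : p = mkseq z (size p).
  apply: (@eq_from_nth _ e) => [|i ip]; first by rewrite size_mkseq.
  by rewrite nth_mkseq // /z modn_small.
rewrite /word_trace asboolT //; split.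
  rewrite !count_map (eq_count (a2 := pred0)) // count_pred0.
  by rewrite (eq_count (a2 := predT)) // count_predT.
exists z; have := act_edges (size p) pz; rewrite -pE.
by congr act; apply/funext => i; rewrite /z modnDl.
Qed.

Lemma word_trace_ghosts d p :
  (0 < d)%N -> word_trace K d [seq LGhost a | a <- p] = 0.
Proof.
move=> d_gt0; rewrite /word_trace asboolF // => -[+ _].
by rewrite !count_map [X in _ = X](eq_count (a2 := pred0)) // count_pred0; lia.
Qed.

End Cycle.

End Words.

Theorem proposition3p9 (K : fieldType) (E : graph)
    (E_cycle : has_cycle E) (L_simple : simple_ring (lpa K E)) :
  skew_elements (@lpa_star K E) <>
  commutator_span (skew_elements (@lpa_star K E)).
Proof.
have [v [[//|e q] cyc]] := E_cycle => skewE.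
pose c : lpa K E := (\pi_(lpa K E) (path_term K e q))%qT.
have c_skew : skew_elements (@lpa_star K E) (c - lpa_star c).
  rewrite /skew_elements /= -[- lpa_star c]scaleN1r lpa_starD lpa_starZ.
  by rewrite lpa_starK !scaleN1r opprD opprK addrC.
have /eqP := lpa_trace_commutator_span (ltn0Sn (size q))
  (eq_ind _ (fun S : set _ => S (c - lpa_star c)) c_skew _ skewE).
rewrite lpa_traceB ?ltn0Sn // /c pi_lpa_star !pi_lpa_trace //.
rewrite pairing_path_term pairing_star_path_term (word_trace_cycle K cyc).
by rewrite word_trace_ghosts // subr0 oner_eq0.
Qed.
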